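(* Let $X\subseteq\mathbb{R}$, $S\subseteq X$, and let $f_n,f:X\to\mathbb{C}$, where $(f_n)_{n\in\mathbb{N}}$ is a sequence of functions. Then the following are equivalent: (a) $(f_n)$ converges (pointwise) to $f$ on $S$. (b) For all $x\in S$ and all $n\in{}^*\mathbb{N}\setminus\mathbb{N}$, ${}^*f_n(x)\approx f(x)$.
   Context: $\mathbb{R}_+$ is the set of positive real numbers and $\mathbb{N}=\{1,2,3,\dots\}$. Fix an ultrafilter $\mathcal{U}$ on $\mathbb{R}_+$ such that $(0,\tfrac1n)\in\mathcal{U}$ for all $n\in\mathbb{N}$. A property of $\varepsilon\in\mathbb{R}_+$ holds almost everywhere (a.e.) if the set of $\varepsilon$ for which it holds belongs to $\mathcal{U}$. For nets $(a_\varepsilon),(b_\varepsilon)\in\mathbb{C}^{\mathbb{R}_+}$ write $(a_\varepsilon)\sim(b_\varepsilon)$ if $a_\varepsilon=b_\varepsilon$ a.e.; $\langle a_\varepsilon\rangle$ is the equivalence class, and ${}^*\mathbb{C}=\mathbb{C}^{\mathbb{R}_+}/\!\sim$ with operations induced pointwise; $\mathbb{C}$ is embedded via constant nets; $|\langle z_\varepsilon\rangle|=\langle|z_\varepsilon|\rangle$. For $A\subseteq\mathbb{C}$, ${}^*A=\{\langle s_\varepsilon\rangle : s_\varepsilon\in A\text{ a.e.}\}$; this defines ${}^*\mathbb{N}$, ${}^*X$ and ${}^*\mathbb{R}$, the last ordered by $\langle a_\varepsilon\rangle<\langle b_\varepsilon\rangle$ iff $a_\varepsilon<b_\varepsilon$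 a.e. For $n=\langle n_\varepsilon\rangle\in{}^*\mathbb{N}$ and $x=\langle x_\varepsilon\rangle\in{}^*X$ (representatives chosen with $n_\varepsilon\in\mathbb{N}$, $x_\varepsilon\in X$ for all $\varepsilon$), ${}^*f_n(x)=\langle f_{n_\varepsilon}(x_\varepsilon)\rangle$. $z\in{}^*\mathbb{C}$ is infinitesimal if $|z|<\tfrac1m$ for all $m\in\mathbb{N}$; $a\approx b$ means $a-b$ is infinitesimal. *)

(* Defs.v *)
(* MathComp-Analysis: the reals are an arbitrary [R : realType], the complex
   numbers are [R[i]] and R_+ is [{posnum R}]. *)
From HB Require Import structures.
From mathcomp Require Import all_boot all_order all_algebra.
From mathcomp Require Import complex generic_quotient.
From mathcomp Require Import all_classical all_reals all_analysis.

Set Implicit Arguments.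
Unset Strict Implicit.
Unset Printing Implicit Defensive.

Import Order.TTheory GRing.Theory Num.Theory.
Import numFieldNormedType.Exports.

Local Open Scope classical_set_scope.
Local Open Scope ring_scope.
Local Open Scope complex_scope.
Local Open Scope quotient_scope.

Section Hyper.
Context {R : realType} (U : set_system {posnum R}) {UF : UltraFilter U}.

Definition net : Type := {posnum R} -> R[i].
HB.instance Definition _ := Choice.on net.

Definition net_eq : rel net := fun a b => `[< \forall e \near U, a e = b e >].

Lemma net_eqP (a b : net) : reflect (\forall e \near U, a e = b e) (net_eq a b).
Proof. exact: asboolP. Qed.

Lemma net_eq_refl : reflexive net_eq.
Proof. by move=> a; apply/net_eqP; apply: nearW. Qed.

Lemma net_eq_sym : symmetric net_eq.
Proof.
by move=> a b; apply/net_eqP/net_eqP => H; apply: filterS H => e ->.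
Qed.

Lemma net_eq_trans : transitive net_eq.
Proof.
move=> b a c /net_eqP H1 /net_eqP H2; apply/net_eqP.
by apply: filterS2 H1 H2 => e -> ->.
Qed.

Canonical net_equiv := EquivRel net_eq net_eq_refl net_eq_sym net_eq_trans.

(* The ultrapower *C *)
Definition hyperC : Type := {eq_quot net_equiv}.
HB.instance Definition _ := Choice.on hyperC.
HB.instance Definition _ := Quotient.on hyperC.

Definition hclass (a : net) : hyperC := \pi_hyperC a.

Lemma hclassP (a b : net) :
  hclass a = hclass b <-> \forall e \near U, a e = b e.
Proof.
by split=> [/eqquotP/net_eqP|H] //; apply/eqquotP/net_eqP.
Qed.

Lemma repr_hclass (a : net) : \forall e \near U, repr (hclass a) e = a e.
Proof. by apply/hclassP; rewrite /hclass reprK. Qed.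

Lemma hclass_repr (z : hyperC) : hclass (repr z) = z.
Proof. exact: reprK. Qed.

Definition hadd (a b : hyperC) : hyperC :=
  hclass (fun e => repr a e + repr b e).
Definition hopp (a : hyperC) : hyperC := hclass (fun e => - repr a e).
Definition hnorm (a : hyperC) : hyperC := hclass (fun e => `|repr a e|).

(* On R[i] the library order [x < y] means that x and y have the same
   imaginary part and ordered real parts, so [hlt] restricted to *R is the
   order of *R. *)
Definition hlt (a b : hyperC) : Prop :=
  \forall e \near U, repr a e < repr b e.

Lemma haddE a b : hadd (hclass a) (hclass b) = hclass (fun e => a e + b e).
Proof.
by apply/hclassP; apply: filterS2 (repr_hclass a) (repr_hclass b) => e -> ->.
Qed.

Lemma hoppE a : hopp (hclass a) = hclass (fun e => - a e).
Proof. by apply/hclassP; apply: filterS (repr_hclass a) => e ->. Qed.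

Lemma hnormE a : hnorm (hclass a) = hclass (fun e => `|a e|).
Proof. by apply/hclassP; apply: filterS (repr_hclass a) => e ->. Qed.

Lemma hltE a b : hlt (hclass a) (hclass b) <-> \forall e \near U, a e < b e.
Proof.
rewrite /hlt; split=> H;
  by apply: filterS3 (repr_hclass a) (repr_hclass b) H => e -> ->.
Qed.

Definition std (c : R[i]) : hyperC := hclass (fun=> c).

Lemma std_inj : injective std.
Proof. by move=> c d /hclassP /filter_ex[]. Qed.

Fact haddA : associative hadd.
Proof.
move=> a b c; rewrite -(hclass_repr a) -(hclass_repr b) -(hclass_repr c).
by rewrite !haddE; apply/hclassP/nearW => e; rewrite addrA.
Qed.

Fact haddC : commutative hadd.
Proof. by move=> a b; apply/hclassP/nearW => e; rewrite addrC. Qed.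

Fact hadd0 : left_id (std 0) hadd.
Proof.
move=> a; rewrite -(hclass_repr a) haddE.
by apply/hclassP/nearW => e; rewrite add0r.
Qed.

Fact haddN : left_inverse (std 0) hopp hadd.
Proof.
move=> a; rewrite -(hclass_repr a) hoppE haddE.
by apply/hclassP/nearW => e; rewrite addNr.
Qed.

HB.instance Definition _ :=
  GRing.isZmodule.Build hyperC haddA haddC hadd0 haddN.

(* The nonstandard extension *A of A *)
Definition star (A : set R[i]) : set hyperC :=
  [set z | exists2 s : net, z = hclass s & \forall e \near U, A (s e)].

Definition infinitesimal (z : hyperC) : Prop :=
  forall m : nat, (0 < m)%N -> hlt (hnorm z) (std m%:R^-1).

Definition happrox (a b : hyperC) : Prop := infinitesimal (a - b).

(* The positive integers and the set X, as subsets of the complex numbers *)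
Definition natC : set R[i] := [set z | exists2 n, (0 < n)%N & z = n%:R].
Definition realC (X : set R) : set R[i] := [set x%:C | x in X].

Definition starfun_val (X : set R) (f : nat -> X -> R[i]) (n x y : hyperC) :=
  exists (k : {posnum R} -> nat) (t : {posnum R} -> X),
    [/\ forall e, (0 < k e)%N, n = hclass (fun e => (k e)%:R),
        x = hclass (fun e => (set_val (t e))%:C)
      & y = hclass (fun e => f (k e) (t e))].

(* *f_n(x) for n in *N and x in *X: the value that [starfun_val] relates to
   n and x, unique by [starfunE]. Outside of *N and *X, it is 0. The sequence
   is indexed by positive integers, so that [f 0] is never used. *)
Definition starfun (X : set R) (f : nat -> X -> R[i]) (n x : hyperC) : hyperC :=
  xget 0 (starfun_val f n x).

Lemma starfunE (X : set R) (f : nat -> X -> R[i])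
    (k : {posnum R} -> nat) (t : {posnum R} -> X) :
  (forall e, (0 < k e)%N) ->
  starfun f (hclass (fun e => (k e)%:R))
            (hclass (fun e => (set_val (t e))%:C)) =
  hclass (fun e => f (k e) (t e)).
Proof.
move=> k0; rewrite /starfun; case: xgetP => [y _|]; last first.
  by move=> /(_ (hclass (fun e => f (k e) (t e)))) []; exists k, t; split.
case=> k' [t' [_ /hclassP kk' /hclassP tt' ->]]; apply/hclassP.
apply: filterS2 kk' tt' => e /eqP; rewrite eqr_nat => /eqP -> [] tt'.
by congr (f _ _); apply/val_inj.
Qed.

Lemma starfun_valP (X : set R) (f : nat -> X -> R[i]) (n x : hyperC) :
  star natC n -> star (realC X) x -> starfun_val f n x (starfun f n x).
Proof.
move=> [s -> sN] [u -> uX].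
have [_ [_ [x0 Xx0 _]]] := filter_ex (filterI sN uX).
have /choice[k kP] : forall e, exists k : nat,
    (0 < k)%N /\ (natC (s e) -> s e = k%:R).
  move=> e; have [[m m0 sm]|Ns] := pselect (natC (s e)); first by exists m.
  by exists 1%N; split=> // /Ns.
have /choice[t tP] : forall e, exists t : X,
    realC X (u e) -> u e = (set_val t)%:C.
  move=> e; have [[r Xr ru]|Nu] := pselect (realC X (u e)); last first.
    by exists (exist _ x0 (mem_set Xx0)) => /Nu.
  by exists (exist _ r (mem_set Xr)).
have -> : hclass s = hclass (fun e => (k e)%:R).
  by apply/hclassP; apply: filterS sN => e /(proj2 (kP e)).
have -> : hclass u = hclass (fun e => (set_val (t e))%:C).
  by apply/hclassP; apply: filterS uX => e /tP.
rewrite starfunE; last by move=> e; case: (kP e).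
by exists k, t; split=> // e; case: (kP e).
Qed.

End Hyper.

Arguments hyperC {R} U {UF}.
Arguments hclass {R} U {UF} a.
Arguments std {R} U {UF} c.
Arguments star {R} U {UF} A.

(* Main.v *)
(* An infinite hypernatural <k_e> satisfies N < k_e a.e. for every standard N,
   and conversely; this turns an index threshold for convergence into an a.e.
   bound.  In the other direction, if convergence fails, one picks bad indices
   b_N >= N for some fixed tolerance; since (0, 1/n) lies in the ultrafilter,
   <b_(floor (1/e) + 1)> is an infinite hypernatural contradicting (b). *)
Require Import Defs.
From mathcomp Require Import all_boot all_order all_algebra.
From mathcomp Require Import complex.
From mathcomp Require Import all_classical all_reals all_analysis.
Import Order.TTheory GRing.Theory Num.Theory.
Import numFieldNormedType.Exports.
Local Open Scope classical_set_scope.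
Local Open Scope ring_scope.
Local Open Scope complex_scope.

Section InfiniteHypernaturals.
Context {R : realType} (U : set_system {posnum R}) {UF : UltraFilter U}.

(** [starfun_valP] already yields a net of positive integers; it is applied to the zero functions at
    the point 0 only to extract that net. *)
Lemma star_natP (n : hyperC U) : star U natC n ->
  exists2 k : {posnum R} -> nat, forall e, (0 < k e)%N &
    n = hclass U (fun e => (k e)%:R).
Proof.
move=> sN; have s0 : star U (realC setT) (std U 0%:C).
  by exists (fun=> 0%:C) => //; apply: nearW => e; exists 0.
by have [k [_ [k0 nk _ _]]] := starfun_valP (fun _ _ => 0) sN s0; exists k.
Qed.

Lemma infinite_natP (k : {posnum R} -> nat) : (forall e, (0 < k e)%N) ->
  ~ (std U @` natC) (hclass U (fun e => (k e)%:R)) <->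
  forall N, \forall e \near U, (N < k e)%N.
Proof.
move=> k0; split=> [kinf | kinf [_ [N _ ->]] /hclassP kN].
  elim=> [|N IH]; first exact: nearW.
  (* Ultrafilter dichotomy: either [k e = N.+1] almost everywhere, which makes the class standard,
     or [k e] avoids [N.+1] almost everywhere and the bound improves by one. *)
  have [kN|kN] := in_ultra_setVsetC [set e | k e = N.+1] UF.
    case: kinf; exists N.+1%:R; first by exists N.+1.
    by apply/hclassP; apply: filterS kN => e /= ->.
  by apply: filterS2 IH kN => e /= Nk /eqP kN; rewrite ltn_neqAle eq_sym kN.
have [e [/= kNe]] := filter_ex (filterI kN (kinf N)).
by move/eqP: kNe; rewrite eqr_nat => /eqP <-; rewrite ltnn.
Qed.

Lemma happrox_stdP (a : net) (c : R[i]) :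
  happrox (hclass U a) (std U c) <->
  forall m, (0 < m)%N -> \forall e \near U, `|a e - c| < m%:R^-1.
Proof.
have -> : happrox (hclass U a) (std U c) =
    infinitesimal (hclass U (fun e => a e - c)).
  by rewrite /happrox -haddE -hoppE.
by split=> H m /H => [|am]; rewrite hnormE; [move/hltE|apply/hltE].
Qed.

End InfiniteHypernaturals.

(** In the order of [R[i]], [0 < eps] forces the imaginary part of [eps] to vanish, so the
    Archimedean property of [R] applies to its real part. *)
Lemma invn_lt_complex {R : realType} (eps : R[i]) : 0 < eps ->
  exists2 m : nat, (0 < m)%N & m%:R^-1 < eps.
Proof.
case: eps => r s; rewrite ltcE /= => /andP[/eqP -> r0].
exists (Num.truncn r^-1).+1 => //.
have -> : (Num.truncn r^-1).+1%:R^-1 = ((Num.truncn r^-1).+1%:R^-1 : R)%:C.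
  by rewrite fmorphV rmorph_nat.
by rewrite ltcR invf_plt ?posrE// truncnS_gt.
Qed.

Theorem theorem4p6p1 (R : realType) (U : set_system {posnum R})
    (UF : UltraFilter U)
    (U0 : forall n : nat, (0 < n)%N ->
       U [set e : {posnum R} | e%:num < n%:R^-1])
    (X S : set R) (SX : S `<=` X)
    (fn : nat -> X -> R[i]) (f : X -> R[i]) :
  (forall x : X, S (set_val x) ->
     (fn n x : R[i]^o) @[n --> \oo] --> (f x : R[i]^o))
  <->
  (forall x : X, S (set_val x) ->
   forall n : hyperC U, (star U natC `\` (std U @` natC)) n ->
     happrox (starfun fn n (std U (set_val x)%:C)) (std U (f x))).
Proof.
split=> [fnf x Sx _ [/star_natP[k k0 ->]] /(infinite_natP _ _ k0) kinf|H x Sx].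
  rewrite (starfunE fn (fun=> x) k0); apply/happrox_stdP => m m0.
  have /cvgrPdist_lt/(_ m%:R^-1) := fnf x Sx.
  rewrite invr_gt0 ltr0n => /(_ m0)[N _ fN].
  by apply: filterS (kinf N) => e /ltnW /fN /=; rewrite distrC.
apply/cvgrPdist_lt => eps eps0; apply: contrapT => Nfnf.
have /choice[b bP] : forall N, exists b : nat,
    (N <= b)%N /\ ~ `|f x - fn b x| < eps.
  move=> N; apply: contrapT => Nb; apply: Nfnf; exists N => // b /= Nleb.
  by apply: contrapT => bad; apply: Nb; exists b.
(* The successor makes the argument of [b] positive, hence also [k e], since [b N] is at least
   [N]. *)
pose k (e : {posnum R}) := b (Num.truncn e%:num^-1).+1.
have k0 e : (0 < k e)%N by apply: leq_trans (proj1 (bP _)).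
have kinf N : \forall e \near U, (N < k e)%N.
  (* Taking [N.+1] instead of [N] covers the case [N = 0], where [U0] does not apply. *)
  apply: filterS (U0 N.+1 isT) => e /= eN; apply: leq_trans (proj1 (bP _)).
  rewrite ltnS truncn_ge_nat// ltW// (le_lt_trans _ (_ : N.+1%:R < _))//.
    by rewrite ler_nat.
  by rewrite -[ltLHS]invrK ltf_pV2 ?posrE.
have kN : (star U natC `\` (std U @` natC)) (hclass U (fun e => (k e)%:R)).
  split; last exact/infinite_natP.
  by exists (fun e => (k e)%:R) => //; apply: nearW => e; exists (k e).
have := H x Sx _ kN; rewrite (starfunE fn (fun=> x) k0) => /happrox_stdP fnx.
have [m m0 meps] := invn_lt_complex _ eps0.
(* A set in the ultrafilter is nonempty, and a single [e] already contradicts the choice of [b]. *)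
have [e fe] := filter_ex (fnx m m0).
by case: (bP (Num.truncn e%:num^-1).+1) => _; apply; rewrite distrC (lt_trans fe).
Qed.
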